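(* Any physical linear graph satisfying $\mathrm{CD}(0,\infty)$ is recurrent.
   Context: A weighted graph $G=(V,E,w,m)$ is a connected, undirected, simple, locally finite graph $(V,E)$ with vertex weights $m:V\to(0,\infty)$ and symmetric edge weights $w:E\to(0,\infty)$, $w(x,y)=w(y,x)$ (with $w(x,y)=0$ if $x\not\sim y$). It is physical if $m\equiv 1$. It is a linear graph if $V=\mathbb{Z}\cap I$ for a (bounded or unbounded) interval $I\subset\mathbb{R}$ and $E=\{\{n,n+1\}: n,n+1\in V\}$. The graph is recurrent if the random walk on $V$ with transition probabilities $w(x,y)/\sum_{z\sim x}w(x,z)$ from $x$ to $y$ is recurrent, i.e. started at any vertex it returns to that vertex with probability one (a walk at a vertex without neighbours stays there). The Laplacian is $\Delta f(x)=\frac1{m(x)}\sum_{y\sim x}w(x,y)(f(y)-f(x))$ for $f:V\to\mathbb{R}$. Set $\Gamma(f,g)=\frac12(\Delta(fg)-f\Delta g-g\Delta f)$, $\Gamma(f)=\Gamma(f,f)$, and $\Gamma_2(f)=\frac12\Delta\Gamma(f)-\Gamma(f,\Delta f)$. For $K\in\mathbb{R}$, $D\in(0,\infty]$ (with $1/\infty=0$) and $x\in V$, the condition $\mathrm{CD}(K,D,x)$ means $\Gamma_2(f)(x)\ge\frac1D(\Delta f(x))^2+K\,\Gamma(f)(x)$ for all $f:V\to\mathbb{R}$; $\mathrm{CD}(K,D)$ means that $\mathrm{CD}(K,D,x)$ holds for all $x\in V$. *)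

(* Defs.v *)
From HB Require Import structures.
From mathcomp Require Import all_boot all_order all_algebra.
From mathcomp Require Import all_classical all_reals all_analysis.

Set Implicit Arguments.
Unset Strict Implicit.
Unset Printing Implicit Defensive.

Import Order.TTheory GRing.Theory Num.Theory.

Local Open Scope classical_set_scope.
Local Open Scope ring_scope.

Record weighted_graph (R : realType) (V : choiceType) := WeightedGraph {
  adj : rel V;
  weight : V -> V -> R;
  vweight : V -> R;
  adj_sym : symmetric adj;
  adj_irr : irreflexive adj;
  adj_connected : forall x y, exists p : seq V, path adj x p /\ last x p = y;
  adj_locally_finite : forall x, finite_set [set y | adj x y];
  vweight_gt0 : forall x, 0 < vweight x;
  weight_sym : forall x y, weight x y = weight y x;
  weight_gt0 : forall x y, adj x y -> 0 < weight x y;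
  weight_eq0 : forall x y, ~~ adj x y -> weight x y = 0
}.

Section WeightedGraph.
Variables (R : realType) (V : choiceType) (G : weighted_graph R V).
Implicit Types (f g : V -> R) (x y : V).

Definition physical := forall x, vweight G x = 1.

Definition laplacian f : V -> R := fun x =>
  (vweight G x)^-1 * \sum_(y \in [set y | adj G x y]) (weight G x y * (f y - f x)).

Definition gamma f g : V -> R := fun x =>
  2^-1 * (laplacian (fun z => f z * g z) x
          - f x * laplacian g x - g x * laplacian f x).

Definition gamma2 f : V -> R := fun x =>
  2^-1 * laplacian (gamma f f) x - gamma f (laplacian f) x.

(* 1/D for D in (0, +oo], with 1/+oo = 0; the value at -oo is irrelevant. *)
Definition inv_dim (D : \bar R) : R := if D is d%:E then d^-1 else 0.

Definition CD_at (K : R) (D : \bar R) x := forall f,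
  inv_dim D * laplacian f x ^+ 2 + K * gamma f f x <= gamma2 f x.

Definition CD (K : R) (D : \bar R) := forall x, CD_at K D x.

Definition degree x : R := \sum_(y \in [set y | adj G x y]) weight G x y.

(* The walk stays put at a vertex without neighbours. *)
Definition transition x y : R :=
  if `[< exists z, adj G x z >] then weight G x y / degree x else (x == y)%:R.

(* X is a Markov chain started at x with the above transition probabilities.
   V carries the discrete sigma-algebra. The Markov property is written with
   joint probabilities, so that no conditioning on null events occurs. *)
Record random_walk_from x d (T : measurableType d) (P : probability T R)
    (X : nat -> T -> V) : Prop := RandomWalkFrom {
  walk_measurable : forall n (A : set V), measurable (X n @^-1` A);
  walk_start : P [set t | X 0%N t = x] = 1%E;
  walk_step : forall n (s : nat -> V),
    P [set t | forall i, (i <= n.+1)%N -> X i t = s i] =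
    (P [set t | forall i, (i <= n)%N -> X i t = s i]
     * (transition (s n) (s n.+1))%:E)%E
}.

(* A walk started at x exists and its law is unique, so its return probability
   does not depend on the realisation; the event is measurable because each
   X n is. *)
Definition recurrent := forall x d (T : measurableType d)
    (P : probability T R) (X : nat -> T -> V),
  random_walk_from x P X -> P [set t | exists n, X n.+1 t = x] = 1%E.

End WeightedGraph.

(* The vertex set Z `&` I; `interval R` covers open, closed, half-open,
   bounded and unbounded intervals. *)
Definition int_itv (R : realType) (I : interval R) : choiceType :=
  {n : int | (n%:~R : R) \in I}.

Definition linear_graph (R : realType) (I : interval R)
    (G : weighted_graph R (int_itv I)) :=
  forall x y : int_itv I,
    adj G x y <-> val y = val x + 1 \/ val x = val y + 1.

(* Main.v *)
Require Import Defs.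
From mathcomp Require Import all_boot all_order all_algebra.
From mathcomp Require Import all_classical all_reals all_analysis.
From mathcomp Require Import zify ring lra.

(** Let q(y) be the probability that the walk started at y <> x never visits x,
and q(x) = 0. Then 0 <= q <= 1 and q is harmonic off x, and the probability of
never returning to x is the one-step average of q at x; so the graph is
recurrent as soon as such a q is also harmonic at x. On a linear graph with edge
weights w_k, harmonicity makes the flux w_k (q(k+1) - q(k)) constant on each side
of x. It vanishes if that side is finite; otherwise q is a multiple of the
partial sums of 1/w_k, so boundedness of q forces it to vanish as soon as
these sums diverge.

Write r_k = w_{k+1} / w_k. CD(0,oo), tested on a piecewise linear function with
w_k (f(k+1) - f(k)) = 1 on the two edges at k, gives
1/r_{k-2} + r_{k-1} + 1/r_{k-1} + r_k <= 4. By the inequality between the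
arithmetic and harmonic means, t_k = (r_k + r_{k-1}) / 2 satisfies
t_{k+1} <= 2 - 1/t_k, hence t_k <= (j+1)/j after j steps. As
w_{k+1} / w_{k-1} <= t_k^2, the weights grow at most linearly and the sum of
1/w_k diverges like the harmonic series. *)

Set Implicit Arguments.
Unset Strict Implicit.
Unset Printing Implicit Defensive.

Import Order.TTheory GRing.Theory Num.Theory.
Import numFieldNormedType.Exports.

Local Open Scope classical_set_scope.
Local Open Scope ring_scope.

(** * One-step averages, harmonicity and survival probabilities *)

Section Walk.
Variables (R : realType) (V : choiceType) (G : weighted_graph R V).
Implicit Types (f g : V -> R) (x y : V).

(** Carries the whole one-step law and is finite, so averages are finite sums. An isolated vertex is
    its own target, since the walk stays there. *)
Definition targets y : set V :=
  if `[< exists z, adj G y z >] then [set z | adj G y z] else [set y].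

Definition average_step f y : R := \sum_(z \in targets y) transition G y z * f z.

Lemma finite_targets y : finite_set (targets y).
Proof. by rewrite /targets; case: ifP => _ //; exact: adj_locally_finite. Qed.

Lemma degree_gt0 y : (exists z, adj G y z) -> 0 < degree G y.
Proof.
move=> [z yz]; rewrite lt_neqAle fsumr_ge0 ?andbT; last first.
  by move=> t /= yt; rewrite ltW // weight_gt0.
apply/eqP => /esym deg0.
have := pfsumr_eq0 (adj_locally_finite G y) _ deg0.
move=> /(_ _ z yz) wz; have := weight_gt0 yz; rewrite wz ?ltxx // => t /= yt.
by rewrite ltW // weight_gt0.
Qed.

Lemma transition_ge0 y z : 0 <= transition G y z.
Proof.
rewrite /transition; case: ifPn => [/asboolP/degree_gt0 d0|_]; last by [].
rewrite divr_ge0 ?(ltW d0) //; case: (boolP (adj G y z)) => yz.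
  by rewrite ltW // weight_gt0.
by rewrite weight_eq0.
Qed.

(** At an isolated vertex the average is [f y] and the Laplacian is an empty sum, so the identity
    survives division by the degree 0. *)
Lemma step_laplacian f y :
  average_step f y = f y + vweight G y / degree G y * laplacian G f y.
Proof.
have m0 := vweight_gt0 G y.
rewrite /average_step /targets /transition /laplacian.
case: ifPn => [/asboolP/[dup] ex /degree_gt0 d0|/asboolPn nex].
  have -> : \sum_(z \in [set z | adj G y z]) (weight G y z * (f z - f y)) =
      \sum_(z \in [set z | adj G y z]) (weight G y z * f z) - degree G y * f y.
    rewrite /degree !(fsbig_finite _ _ (adj_locally_finite G y)) /=.
    by rewrite mulr_suml -sumrB; apply: eq_bigr => z _; rewrite mulrBr.
  transitivity ((degree G y)^-1 *
      \sum_(z \in [set z | adj G y z]) (weight G y z * f z)).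
    by rewrite mulr_fsumr; apply: eq_fsbigr => z _; rewrite mulrAC mulrC.
  by field; rewrite !gt_eqF.
rewrite fsbig_set1 eqxx mul1r [X in _ * (_ * X)]fsbig1 ?mulr0 ?addr0 // => z yz.
by case: nex; exists z.
Qed.

Lemma step_fixed f y : average_step f y = f y <-> laplacian G f y = 0.
Proof.
rewrite step_laplacian; split=> [|->]; last by rewrite mulr0 addr0.
case: (pselect (exists z, adj G y z)) => [/degree_gt0 d0|nex] h.
  have /eqP : vweight G y / degree G y * laplacian G f y = 0.
    by apply: (addrI (f y)); rewrite h addr0.
  rewrite mulf_eq0 gt_eqF /= => [/eqP//|]; exact: divr_gt0 (vweight_gt0 G y) d0.
by rewrite /laplacian [X in _ * X]fsbig1 ?mulr0 // => z yz; case: nex; exists z.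
Qed.

Lemma step_cst c y : average_step (fun=> c) y = c.
Proof.
apply/step_fixed; rewrite /laplacian fsbig1 ?mulr0 // => z _.
by rewrite subrr mulr0.
Qed.

Lemma transition_sum1 y : \sum_(z \in targets y) transition G y z = 1.
Proof.
by rewrite -[RHS](step_cst 1 y) /average_step; apply: eq_fsbigr => z _; rewrite mulr1.
Qed.

Lemma step_le f g y : (forall z, f z <= g z) -> average_step f y <= average_step g y.
Proof.
move=> fg; rewrite /average_step 2!(fsbig_finite _ _ (finite_targets y)) /=.
by apply: ler_sum => z _; rewrite ler_wpM2l ?transition_ge0.
Qed.

Lemma step_cvg (F : nat -> V -> R) f y :
  (forall z, F n z @[n --> \oo] --> f z) ->
  average_step (F n) y @[n --> \oo] --> average_step f y.
Proof.
move=> Ff; rewrite /average_step (fsbig_finite _ _ (finite_targets y)) /=.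
under eq_fun do rewrite (fsbig_finite _ _ (finite_targets y)) /=.
by apply: cvg_big => [|z _]; [exact: add_continuous|apply: cvgMr; exact: Ff].
Qed.

(* The probability that the walk started at y avoids x at the times 1, ..., m. *)
Fixpoint survival x m : V -> R :=
  if m is m'.+1 then average_step (fun z => (z != x)%:R * survival x m' z) else fun=> 1.

Lemma survival_bound x m y : 0 <= survival x m.+1 y <= survival x m y.
Proof.
elim: m y => [|m IH] y.
  rewrite /= -[X in _ <= _ <= X](step_cst 1 y) -[X in X <= _ <= _](step_cst 0 y).
  by apply/andP; split; apply: step_le => z; rewrite mulr1; case: (_ != _).
apply/andP; split.
  rewrite -[leLHS](step_cst 0 y); apply: step_le => z; rewrite mulr_ge0 //.
  by case/andP: (IH z).
by apply: step_le => z; rewrite ler_wpM2l //; case/andP: (IH z).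
Qed.

Lemma survival_ge0 x m y : 0 <= survival x m y.
Proof. by case: m => [|m] //; case/andP: (survival_bound x m y). Qed.

Lemma survival_le1 x m y : survival x m y <= 1.
Proof.
by elim: m => [|m IH] //; apply: le_trans IH; case/andP: (survival_bound x m y).
Qed.

(** Survival probabilities decrease to a limit s. Let [q] be s off [x] and 0 at [x]. Passing to the
    limit in the recursion shows that s is the one-step average of [q] everywhere. So [q] is
    harmonic off [x]; once it is harmonic at [x] too, s(x) = q(x) = 0. *)
Lemma survival_cvg0 x :
  (forall q : V -> R, q x = 0 -> (forall y, 0 <= q y <= 1) ->
     (forall y, y != x -> laplacian G q y = 0) -> laplacian G q x = 0) ->
  survival x m x @[m --> \oo] --> 0.
Proof.
move=> liouville.
have cv y : cvgn (fun m => survival x m y).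
  apply: nonincreasing_is_cvgn.
    by apply/nonincreasing_seqP => m; case/andP: (survival_bound x m y).
  by exists 0 => _ [m _ <-]; exact: survival_ge0.
pose q y := (y != x)%:R * limn (fun m => survival x m y).
have limS y : limn (fun m => survival x m y) = average_step q y.
  apply: cvg_lim => //; rewrite -(cvg_shiftS (fun m => survival x m y)) /=.
  by apply: step_cvg => z; apply: cvgMr; exact: cv.
have qx : q x = 0 by rewrite /q eqxx mul0r.
have -> : 0 = limn (fun m => survival x m x); last exact: cv.
rewrite limS -qx; apply/esym/step_fixed/liouville => // y.
- rewrite /q; case: (_ != _); rewrite ?mul0r ?mul1r ?lexx ?ler01 //.
  apply/andP; split.
    by apply: limr_ge; [exact: cv|apply: nearW => m; exact: survival_ge0].
  by apply: limr_le; [exact: cv|apply: nearW => m; exact: survival_le1].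
- by move=> yx; apply/step_fixed; rewrite -limS /q yx mul1r.
Qed.

End Walk.

(** * From survival probabilities to the law of the walk *)

Section Law.
Variables (R : realType) (V : choiceType) (G : weighted_graph R V).
Variables (x : V) (d : measure_display) (T : measurableType d).
Variables (P : probability T R) (X : nat -> T -> V).
Hypothesis walk : random_walk_from G x P X.

Definition cylinder n (s : nat -> V) : set T :=
  [set t | forall i, (i <= n)%N -> X i t = s i].

Definition avoid n m : set T := [set t | forall i, (n < i <= n + m)%N -> X i t <> x].

Definition extend n (s : nat -> V) z i := if i == n.+1 then z else s i.

Lemma measurable_cylinder n s : measurable (cylinder n s).
Proof.
have -> : cylinder n s = \bigcap_(i in [set i | (i <= n)%N]) X i @^-1` [set s i].
  by [].
by apply: bigcap_measurableType => i _; exact: (walk_measurable walk).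
Qed.

Lemma measurable_avoid n m : measurable (avoid n m).
Proof.
have -> : avoid n m = \bigcap_(i in [set i | (n < i <= n + m)%N]) X i @^-1` [set~ x].
  by [].
by apply: bigcap_measurableType => i _; exact: (walk_measurable walk).
Qed.

Lemma cylinder_extendE n s z :
  cylinder n.+1 (extend n s z) = cylinder n s `&` X n.+1 @^-1` [set z].
Proof.
apply/seteqP; split=> t /=.
  move=> h; split=> [i ilen|]; last by rewrite (h n.+1 (leqnn _)) /extend eqxx.
  by rewrite (h i (leqW ilen)) /extend ltn_eqF.
move=> [h1 h2] i; rewrite leq_eqVlt /extend.
by case: eqP => [-> _|_ /= /h1].
Qed.

Lemma cylinder_extend n s z : P (cylinder n.+1 (extend n s z)) =
  (P (cylinder n s) * (transition G (s n) z)%:E)%E.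
Proof.
rewrite /cylinder (walk_step walk); congr (P _ * (transition G _ _)%:E)%E.
- by apply/seteqP; split=> t /= h i ilen; rewrite h // /extend ltn_eqF.
- by rewrite /extend ltn_eqF.
- by rewrite /extend eqxx.
Qed.

Lemma trivIset_cylinder n s (D : set V) :
  trivIset D (fun z => cylinder n.+1 (extend n s z)).
Proof.
by move=> y z _ _ [t []]; rewrite !cylinder_extendE => -[_ /= <-] [_ /= <-].
Qed.

(** The transition probabilities over the targets sum to 1, so finitely many disjoint extensions
    exhaust the mass of the cylinder. Finite additivity then suffices to condition on the next
    step. *)
Lemma leave_targets_null n s : P (cylinder n s `\`
  \bigcup_(z in targets G (s n)) cylinder n.+1 (extend n s z)) = 0%E.
Proof.
have mU : measurable (\bigcup_(z in targets G (s n)) cylinder n.+1 (extend n s z)).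
  apply: fin_bigcup_measurable => [|z _]; first exact: finite_targets.
  exact: measurable_cylinder.
have mC := measurable_cylinder n s.
rewrite measureD // ?(le_lt_trans (probability_le1 _ _)) ?ltry //.
have fC : P (cylinder n s) \is a fin_num by rewrite fin_num_measure.
rewrite setIidr; last first.
  by move=> t [z _]; rewrite cylinder_extendE => -[].
rewrite measure_fin_bigcup //; last 3 first.
- exact: finite_targets.
- exact: trivIset_cylinder.
- by move=> z _; exact: measurable_cylinder.
suff -> : \sum_(z \in targets G (s n)) P (cylinder n.+1 (extend n s z)) =
    P (cylinder n s) by rewrite subee.
transitivity (\sum_(z \in targets G (s n))
    (fine (P (cylinder n s)) * transition G (s n) z)%:E)%E.
  by apply: eq_fsbigr => z _; rewrite cylinder_extend EFinM fineK.
rewrite fsumEFin; last exact: finite_targets.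
by rewrite -mulr_fsumr transition_sum1 mulr1 fineK.
Qed.

(** Induction on [m]: up to a null event, split according to the vertex at time [n.+1], as in the
    recursion for [survival]. *)
Lemma avoid_bound m n s :
  (P (cylinder n s `&` avoid n m) <= P (cylinder n s) * (survival G x m (s n))%:E)%E.
Proof.
elim: m n s => [|m IH] n s.
  rewrite mule1; apply: le_measure; rewrite ?inE; last exact: subIsetl.
    by apply: measurableI; [exact: measurable_cylinder|exact: measurable_avoid].
  exact: measurable_cylinder.
(* The last set does not depend on [t]: it is everything or empty, and makes [E x] empty to match
   the factor [(z != x)%:R] in [survival]. *)
pose E z := cylinder n.+1 (extend n s z) `&`
  (avoid n.+1 m `&` [set t | z <> x]).
have mE z : measurable (E z).
  apply: measurableI; first exact: measurable_cylinder.
  apply: measurableI; first exact: measurable_avoid.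
  case: (pselect (z = x)) => zx.
    by rewrite [X in measurable X](_ : _ = set0) //; apply/seteqP; split=> t.
  by rewrite [X in measurable X](_ : _ = setT) //; apply/seteqP; split=> t.
set N := cylinder n s `\`
  \bigcup_(z in targets G (s n)) cylinder n.+1 (extend n s z).
have mU : measurable (\bigcup_(z in targets G (s n)) E z).
  by apply: fin_bigcup_measurable => //; exact: finite_targets.
have mN : measurable N.
  apply: measurableD; first exact: measurable_cylinder.
  apply: fin_bigcup_measurable => [|z _]; first exact: finite_targets.
  exact: measurable_cylinder.
have sub : cylinder n s `&` avoid n m.+1 `<=`
    N `|` \bigcup_(z in targets G (s n)) E z.
  move=> t [cyl av]; case: (pselect (N t)) => [|nN]; first by left.
  right; have : (\bigcup_(z in targets G (s n)) cylinder n.+1 (extend n s z)) t.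
    by apply: contrapT => h; apply: nN; split.
  move=> [z nz cz]; exists z => //; split=> //; split.
    by move=> i /andP[i1 i2]; apply: av; lia.
  move: cz; rewrite cylinder_extendE => -[_ /= <-]; apply: av; lia.
have fC : P (cylinder n s) \is a fin_num.
  by rewrite fin_num_measure //; exact: measurable_cylinder.
apply: le_trans (le_measure P _ _ sub) _; rewrite ?inE.
- by apply: measurableI; [exact: measurable_cylinder|exact: measurable_avoid].
- exact: measurableU.
apply: le_trans (measureU2 P mN mU) _.
rewrite [X in (X + _ <= _)%E]leave_targets_null add0e.
rewrite measure_fin_bigcup //; last 2 first.
- exact: finite_targets.
- move=> y z Dy Dz [t [[ct _] [ct' _]]].
  by apply: (@trivIset_cylinder n s _ y z Dy Dz); exists t.
rewrite -(fineK fC) -EFinM /= /average_step mulr_fsumr -fsumEFin; last first.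
  exact: finite_targets.
apply: lee_fsum => [|z _]; first exact: finite_targets.
set c := (z != x)%:R * _; rewrite mulrA (EFinM _ c) (EFinM (fine _)).
rewrite (fineK fC) -cylinder_extend /c {c}.
case: (eqVneq z x) => [zx|zx] /=.
  rewrite mul0r mule0 (_ : E z = set0) ?measure0 //.
  by apply/seteqP; split=> t // [_ [_]].
rewrite mul1r; have := IH n.+1 (extend n s z); rewrite {3}/extend eqxx.
apply: le_trans; apply: le_measure; rewrite ?inE.
- exact: mE.
- by apply: measurableI; [exact: measurable_cylinder|exact: measurable_avoid].
by move=> t [? []].
Qed.

(** Almost every path starts at [x], so for each [m] the probability of never returning is at most
    [survival G x m x]. *)
Lemma return_prob1 : survival G x m x @[m --> \oo] --> 0 ->
  P [set t | exists n, X n.+1 t = x] = 1%E.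
Proof.
move=> s0.
set A := [set t | _].
have mA : measurable A.
  rewrite (_ : A = \bigcup_n X n.+1 @^-1` [set x]); last first.
    by apply/seteqP; split=> t [n]; [exists n|exists n].
  by apply: bigcup_measurable => n _; exact: (walk_measurable walk).
set C := cylinder 0 (fun=> x).
have C1 : P C = 1%E.
  rewrite -(walk_start walk); congr (P _); apply/seteqP; split=> t /=; first exact.
  by move=> h i; rewrite leqn0 => /eqP ->.
have mC : measurable C by exact: measurable_cylinder.
have bnd m : (P (~` A) <= (survival G x m x)%:E)%E.
  have sub : ~` A `<=` ~` C `|` (C `&` avoid 0 m).
    move=> t nA; case: (pselect (C t)) => Ct; [right|by left].
    by split=> // -[//|i] _ Xi; apply: nA; exists i.
  have mav := measurable_avoid 0 m.
  apply: le_trans (le_measure P _ _ sub) _; rewrite ?inE; [exact: measurableC| |].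
    by apply: measurableU; [exact: measurableC|exact: measurableI].
  apply: le_trans (measureU2 P _ _) _; [exact: measurableC|exact: measurableI|].
  have PC : P (~` C) = 0%E by rewrite probability_setC // C1 subee.
  rewrite [X in (X + _ <= _)%E]PC add0e.
  by have := avoid_bound m 0 (fun=> x); rewrite -/C [X in (X * _)%E]C1 mul1e.
have : (P (~` A) <= 0)%E.
  have fA : P (~` A) \is a fin_num by rewrite fin_num_measure //; exact: measurableC.
  rewrite -(fineK fA) lee_fin -(cvg_lim _ s0) //.
  apply: limr_ge; first by apply/cvg_ex; exists 0.
  by apply: nearW => m; rewrite -lee_fin fineK.
rewrite probability_setC // => h.
by apply/eqP; rewrite eq_le probability_le1 //= -sube_le0.
Qed.

End Law.

Lemma recurrent_of_liouville (R : realType) (V : choiceType)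
    (G : weighted_graph R V) :
  (forall x (q : V -> R), q x = 0 -> (forall y, 0 <= q y <= 1) ->
     (forall y, y != x -> laplacian G q y = 0) -> laplacian G q x = 0) ->
  recurrent G.
Proof.
move=> liouville x d T P X walk; apply: (return_prob1 walk); apply: survival_cvg0.
exact: liouville.
Qed.

(** * Linear growth of positive weights under the curvature inequality *)

Section LinearGrowth.
Variables (R : realType) (v : nat -> R).
Hypothesis v_gt0 : forall j, 0 < v j.
Hypothesis v_curv : forall j, v j / v j.+1 + v j.+2 / v j.+1
  + v j.+1 / v j.+2 + v j.+3 / v j.+2 <= 4.

Let tau j := (v j.+1 / v j + v j.+2 / v j.+1) / 2.

Lemma mean_ratio_gt0 j : 0 < tau j.
Proof. by rewrite /tau divr_gt0 // addr_gt0 // divr_gt0. Qed.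

Lemma mean_ratio_step j : tau j.+1 <= 2 - (tau j)^-1.
Proof.
have t0 := mean_ratio_gt0 j.
have am_hm : (tau j)^-1 <= (v j / v j.+1 + v j.+1 / v j.+2) / 2.
  rewrite -[leLHS]mul1r ler_pdivrMr // /tau.
  have h0 := v_gt0 j; have h1 := v_gt0 j.+1; have h2 := v_gt0 j.+2.
  set a := v j.+1 / v j; set b := v j.+2 / v j.+1.
  have a0 : 0 < a by rewrite divr_gt0.
  have b0 : 0 < b by rewrite divr_gt0.
  rewrite -[v j / _]invf_div -/a -[v j.+1 / v j.+2]invf_div -/b.
  have -> : (a^-1 + b^-1) / 2 * ((a + b) / 2) = 1 + (a - b) ^+ 2 / (4 * a * b).
    by field; rewrite ?(gt_eqF a0) ?(gt_eqF b0).
  rewrite lerDl; apply: divr_ge0; first exact: sqr_ge0.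
  by have := mulr_gt0 a0 b0; lra.
by have := v_curv j; rewrite /tau in am_hm *; lra.
Qed.

(** The bound solves the recursion with equality, as 2 - (j+1)/(j+2) = (j+3)/(j+2), and t -> 2 - 1/t
    is increasing for t > 0. The start [tau 1 <= 2] holds whatever [tau 0] is. *)
Lemma mean_ratio_le j : tau j.+1 <= j.+2%:R / j.+1%:R.
Proof.
elim: j => [|j IH]; apply: le_trans (mean_ratio_step _) _.
  have := mean_ratio_gt0 0; rewrite -invr_gt0 => h; rewrite divr1; lra.
have t0 := mean_ratio_gt0 j.+1.
have : (j.+2%:R / j.+1%:R)^-1 <= (tau j.+1)^-1.
  by rewrite lef_pV2 ?posrE // divr_gt0.
rewrite invf_div => h; rewrite lerBlDr; apply: le_trans
  (_ : _ <= j.+3%:R / j.+2%:R + j.+1%:R / j.+2%:R) _; last by rewrite lerD2l.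
rewrite -mulrDl -natrD ler_pdivlMr // -natrM ler_nat; lia.
Qed.

(** Since [tau] controls the growth over two steps, the induction carries two consecutive bounds;
    the constant covers both initial values. The step closes because (j+1)(j+3) <= (j+2)^2. *)
Lemma linear_growth j : v j.+2 <= (v 2%N + v 3%N) * j.+1%:R.
Proof.
set K := _ + _.
have K0 : 0 < K by rewrite addr_gt0.
suff : v j.+2 <= K * j.+1%:R /\ v j.+3 <= K * j.+2%:R by case.
elim: j => [|j [IH1 IH2]].
  by rewrite mulr1 /K; have := v_gt0 2; have := v_gt0 3; split; lra.
split=> //.
have h2 := v_gt0 j.+2; have h3 := v_gt0 j.+3; have h4 := v_gt0 j.+4.
have sq : v j.+4 / v j.+2 <= (tau j.+2) ^+ 2.
  have -> : v j.+4 / v j.+2 = (v j.+3 / v j.+2) * (v j.+4 / v j.+3).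
    by field; rewrite ?(gt_eqF h2) ?(gt_eqF h3).
  rewrite /tau; have := sqr_ge0 (v j.+3 / v j.+2 - v j.+4 / v j.+3); lra.
have {sq} : v j.+4 <= (j.+3%:R / j.+2%:R) ^+ 2 * v j.+2.
  rewrite -ler_pdivrMr //; apply: le_trans sq _.
  have t0 := mean_ratio_gt0 j.+2; have le := mean_ratio_le j.+1.
  by rewrite !expr2; apply: ler_pM => //; exact: ltW.
move=> /le_trans; apply.
apply: le_trans (_ : _ <= (j.+3%:R / j.+2%:R) ^+ 2 * (K * j.+1%:R)) _.
  by rewrite ler_wpM2l // exprn_ge0 // divr_ge0.
rewrite mulrCA ler_pM2l // expr_div_n mulrAC ler_pdivrMr ?exprn_gt0 //.
rewrite -!natrX -!natrM ler_nat -mulnn -mulnA leq_mul2l -mulnn; nia.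
Qed.

Lemma sum_inv_unbounded (M : R) : exists n, M < \sum_(j < n) (v j)^-1.
Proof.
apply: contrapT => /forallNP bnd.
set K := v 2%N + v 3%N.
have K0 : 0 < K by rewrite addr_gt0.
apply: (@dvg_harmonic R); apply: nondecreasing_is_cvgn.
  by apply: nondecreasing_series => k _ _; rewrite /harmonic invr_ge0.
exists (K * M) => _ [n _ <-].
rewrite /series /= big_mkord.
apply: le_trans (_ : _ <= K * \sum_(j < n) (v j.+2)^-1) _.
  rewrite mulr_sumr; apply: ler_sum => j _.
  by rewrite /harmonic ler_pdivlMr // mulrC ler_pdivrMr // linear_growth.
rewrite ler_pM2l //; have /negP := bnd n.+2; rewrite -leNgt; apply: le_trans.
rewrite 2!big_ord_recl; do 2![apply: ler_wpDl; first by rewrite invr_ge0 ltW].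
exact: lexx.
Qed.

End LinearGrowth.

(** One side of the starting vertex: [h j] is the value at distance [j], and [v j] the weight of the
    edge from distance [j] to [j.+1]. A zero weight, marking the end of a finite side, kills the
    constant flux at once. *)
Lemma bounded_flux_eq0 (R : realType) (v h : nat -> R) :
  (forall j, 0 <= v j) ->
  (forall j, 0 < v j.+1 -> 0 < v j.+2 -> v j / v j.+1 + v j.+2 / v j.+1
     + v j.+1 / v j.+2 + v j.+3 / v j.+2 <= 4) ->
  h 0%N = 0 -> (forall j, 0 <= h j <= 1) ->
  (forall j, v j.+1 * (h j.+2 - h j.+1) = v j * (h j.+1 - h j)) ->
  v 0%N * h 1%N = 0.
Proof.
move=> v0 vc h0 hb hv.
have flux j : v j * (h j.+1 - h j) = v 0%N * h 1%N.
  by elim: j => [|j IH]; rewrite ?h0 ?subr0 // hv.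
case: (pselect (exists j, v j = 0)) => [[j vj]|/forallNP nz].
  by rewrite -(flux j) vj mul0r.
have vp j : 0 < v j by rewrite lt_neqAle v0 andbT eq_sym; apply/eqP/nz.
set c := v 0%N * h 1%N in flux *.
have c0 : 0 <= c by rewrite mulr_ge0 //; case/andP: (hb 1%N).
apply/eqP; rewrite eq_le c0 andbT leNgt; apply/negP => cp.
(* With this threshold [h n], the flux times the sum, would exceed 1. *)
have [n] := sum_inv_unbounded vp (fun j => vc j (vp _) (vp _)) c^-1.
suff e : h n = c * \sum_(j < n) (v j)^-1.
  have /andP[_] := hb n; rewrite e => le1.
  by rewrite ltNge -[leRHS]mul1r ler_pdivlMr // mulrC le1.
elim: n => [|n IH]; first by rewrite big_ord0 mulr0.
rewrite big_ord_recr mulrDr -IH /= -(flux n) mulrAC divff ?mul1r ?(gt_eqF (vp _)) //.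
by rewrite addrC subrK.
Qed.

(** * Linear graphs as weights on the integers *)

Section LinearGraph.
Variables (R : realType) (I : interval R) (G : weighted_graph R (int_itv I)).
Hypotheses (lin : linear_graph G) (phys : physical G).
Implicit Types (F H : int -> R) (k : int) (y : int_itv I).

Definition vertex_at k : option (int_itv I) := insub k.

(* The weight of {k, k+1}. Its value 0 off the edges lets the formulas below hold
   at end vertices too, whatever the values of a function outside the interval. *)
Definition edge_weight k : R :=
  if (vertex_at k, vertex_at (k + 1)) is (Some y, Some z) then weight G y z else 0.

Lemma vertex_atP k y : vertex_at k = Some y <-> val y = k.
Proof.
split=> [|<-]; last exact: valK.
by rewrite /vertex_at; case: insubP => // z _ <- [->].
Qed.

Lemma edge_weight_ge0 k : 0 <= edge_weight k.
Proof.
rewrite /edge_weight; case: (vertex_at k) => // y; case: (vertex_at (k + 1)) => // z.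
case: (boolP (adj G y z)) => yz; first by rewrite ltW // weight_gt0.
by rewrite weight_eq0.
Qed.

Definition int_laplacian F k : R :=
  edge_weight k * (F (k + 1) - F k) + edge_weight (k - 1) * (F (k - 1) - F k).

Lemma laplacian_int F y : laplacian G (F \o val) y = int_laplacian F (val y).
Proof.
rewrite /laplacian phys invr1 mul1r.
(* [pmap] drops the integers outside the interval; the matching terms of [int_laplacian] have weight
   0. *)
have -> : [set z | adj G y z] = [set` pmap vertex_at [:: val y + 1; val y - 1]].
  apply/seteqP; split=> z; rewrite /mkset mem_pmap.
    move=> /lin[|] h; apply/mapP; [exists (val y + 1)|exists (val y - 1)];
    rewrite ?inE ?eqxx ?orbT //; apply/esym/vertex_atP; rewrite h //.
    by rewrite addrK.
  move=> /mapP[k]; rewrite !inE => /orP[]/eqP-> /esym/vertex_atP h;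
  apply/lin; rewrite h.
    by left.
  by right; rewrite subrK.
rewrite -fsbig_seq; last first.
  apply: (pmap_uniq (g := val)); first by move=> k; rewrite /vertex_at; case: insubP.
  by rewrite /= inE andbT; apply/eqP; lia.
have vy : vertex_at (val y) = Some y by apply/vertex_atP.
rewrite /int_laplacian /edge_weight vy subrK vy /=.
case e1: (vertex_at (val y + 1)) => [z1|]; case e2: (vertex_at (val y - 1)) => [z2|] /=;
rewrite ?big_cons ?big_nil ?mul0r ?addr0 ?add0r //;
try (move/vertex_atP: e1 => <-); try (move/vertex_atP: e2 => <-);
by rewrite ?(weight_sym G y z2).
Qed.

Definition int_gamma F H k : R :=
  2^-1 * (int_laplacian (fun j => F j * H j) k
          - F k * int_laplacian H k - H k * int_laplacian F k).

Lemma gamma_int F H : gamma G (F \o val) (H \o val) = int_gamma F H \o val.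
Proof.
by apply/funext => y; rewrite /gamma /int_gamma /= -!laplacian_int.
Qed.

Lemma CD_curvature k : CD G 0 +oo%E ->
  0 < edge_weight (k - 1) -> 0 < edge_weight k ->
  edge_weight (k - 2) / edge_weight (k - 1) + edge_weight k / edge_weight (k - 1)
  + edge_weight (k - 1) / edge_weight k + edge_weight (k + 1) / edge_weight k <= 4.
Proof.
move=> cd wb wc.
have [y yk] : exists y, val y = k.
  move: wc; rewrite /edge_weight; case e: (vertex_at k) => [y|]; rewrite ?ltxx // => _.
  by exists y; apply/vertex_atP.
set b := edge_weight (k - 1) in wb *; set c := edge_weight k in wc *.
(* The unit flux on both edges at [k] makes the Laplacian vanish there. Keeping the same slopes up
   to [k - 2] and [k + 2] minimizes [gamma2] at [k] over the values at these two points. *)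
pose F j : R := if k <= j then (j - k)%:~R / c else (j - k)%:~R / b.
have := cd y (F \o val).
rewrite mul0r mul0r addr0 /gamma2 gamma_int.
have -> : laplacian G (F \o val) = int_laplacian F \o val.
  by apply/funext => z; exact: laplacian_int.
rewrite gamma_int laplacian_int /= yk.
have F0 : F k = 0 by rewrite /F lexx subrr mul0r.
have F1 : F (k + 1) = c^-1.
  rewrite /F ifT; last lia.
  by rewrite (_ : k + 1 - k = 1) ?mul1r //; lia.
have F2 : F (k + 2) = 2 / c.
  rewrite /F ifT; last lia.
  by rewrite (_ : k + 2 - k = 2) //; lia.
have Fm1 : F (k - 1) = - b^-1.
  rewrite /F ifF; last lia.
  by rewrite (_ : k - 1 - k = -1) ?mulN1r //; lia.
have Fm2 : F (k - 2) = - 2 / b.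
  rewrite /F ifF; last lia.
  by rewrite (_ : k - 2 - k = -2) //; lia.
rewrite /int_gamma /int_laplacian.
rewrite (_ : k + 1 + 1 = k + 2); last lia.
rewrite (_ : k - 1 - 1 = k - 2); last lia.
rewrite (_ : k + 1 - 1 = k); last lia.
rewrite (_ : k - 1 + 1 = k); last lia.
rewrite F0 F1 F2 Fm1 Fm2 -/b -/c.
set a := edge_weight (k - 2); set e := edge_weight (k + 1).
set L := (X in _ <= X) => L0.
(* [L] is [gamma2] of the test function at [k], nonnegative by [L0]. *)
suff : 4 * L = 4 - (a / b + c / b + b / c + e / c) by lra.
by rewrite /L; field; rewrite !gt_eqF.
Qed.

Lemma linear_liouville (x : int_itv I) (q : int_itv I -> R) :
  CD G 0 +oo%E -> q x = 0 -> (forall y, 0 <= q y <= 1) ->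
  (forall y, y != x -> laplacian G q y = 0) -> laplacian G q x = 0.
Proof.
move=> cd qx q01 harm.
(* The default 0 outside the interval preserves the bounds 0 and 1. *)
pose Q k : R := oapp q 0 (vertex_at k).
have qE : q = Q \o val.
  by apply/funext => y; rewrite /Q /=; have /vertex_atP -> : val y = val y by [].
have Q01 k : 0 <= Q k <= 1.
  by rewrite /Q; case: (vertex_at k) => //=; rewrite lexx ler01.
have Qx : Q (val x) = 0 by rewrite -qx qE.
(* Outside the interval both adjacent weights are 0, so harmonicity is automatic. *)
have harmQ k : k != val x -> int_laplacian Q k = 0.
  move=> kx; case e: (vertex_at k) => [y|]; last first.
    rewrite /int_laplacian /edge_weight subrK e.
    by case: (vertex_at (k - 1)); rewrite !mul0r addr0.
  move/vertex_atP: e => ek; rewrite -ek -laplacian_int -qE harm //.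
  by apply: contra kx => /eqP <-; apply/eqP.
rewrite qE laplacian_int /int_laplacian Qx !subr0; set k := val x in Qx harmQ *.
have right : edge_weight k * Q (k + 1) = 0.
  have := @bounded_flux_eq0 R (fun j => edge_weight (k + j%:Z))
    (fun j => Q (k + j%:Z)).
  rewrite addr0; apply => //.
  - by move=> j; exact: edge_weight_ge0.
  - move=> j v1 v2; have := @CD_curvature (k + j.+2%:Z) cd.
    rewrite (_ : k + j.+2%:Z - 1 = k + j.+1%:Z); last lia.
    rewrite (_ : k + j.+2%:Z - 2 = k + j%:Z); last lia.
    rewrite (_ : k + j.+2%:Z + 1 = k + j.+3%:Z); last lia.
    exact.
  - move=> j; have := harmQ (k + j.+1%:Z); rewrite /int_laplacian.
    rewrite (_ : k + j.+1%:Z - 1 = k + j%:Z); last lia.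
    rewrite (_ : k + j.+1%:Z + 1 = k + j.+2%:Z); last lia.
    move=> h; have {}h := h ltac:(lia); lra.
(* The reflected case: edge [j] now joins [k - 1 - j] and [k - j], hence the shift by one in the
   weights. The curvature inequality is invariant under reversal. *)
have left : edge_weight (k - 1) * Q (k - 1) = 0.
  have := @bounded_flux_eq0 R (fun j => edge_weight (k - 1 - j%:Z))
    (fun j => Q (k - j%:Z)).
  rewrite !subr0; apply => //.
  - by move=> j; exact: edge_weight_ge0.
  - move=> j v1 v2; have := @CD_curvature (k - 1 - j.+1%:Z) cd.
    rewrite (_ : k - 1 - j.+1%:Z - 1 = k - 1 - j.+2%:Z); last lia.
    rewrite (_ : k - 1 - j.+1%:Z - 2 = k - 1 - j.+3%:Z); last lia.
    rewrite (_ : k - 1 - j.+1%:Z + 1 = k - 1 - j%:Z); last lia.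
    move=> /(_ v2 v1); lra.
  - move=> j; have := harmQ (k - j.+1%:Z); rewrite /int_laplacian.
    rewrite (_ : k - j.+1%:Z - 1 = k - j.+2%:Z); last lia.
    rewrite (_ : k - j.+1%:Z + 1 = k - j%:Z); last lia.
    rewrite (_ : k - 1 - j.+1%:Z = k - j.+2%:Z); last lia.
    rewrite (_ : k - 1 - j%:Z = k - j.+1%:Z); last lia.
    move=> h; have {}h := h ltac:(lia); lra.
by rewrite right left addr0.
Qed.

End LinearGraph.

Theorem corollary3p15 (R : realType) (I : interval R)
    (G : weighted_graph R (int_itv I)) :
  linear_graph G -> physical G -> CD G 0%R +oo%E -> recurrent G.
Proof.
move=> lin phys cd; apply: recurrent_of_liouville => x q.
exact: linear_liouville.
Qed.
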